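(* Let $N>0$ and $L\in\mathbb{Z}_{\ge2}$. Then $\overline{C}_{L-1}(N)\ge\frac12\ln\frac{L-1}{4\pi eLN}$.
   Context: For $x_1,\dots,x_L\in\mathbb{R}^n$ with centroid $\bar x=\frac1L\sum_ix_i$, $\overline{\mathrm{rad}}^2(x_1,\dots,x_L)=\frac1L\sum_i\|x_i-\bar x\|_2^2$. A set $\mathcal{C}\subseteq\mathbb{R}^n$ is an $(N,L-1)$-average-radius list-decodable code if every $L$ distinct points of $\mathcal{C}$ have $\overline{\mathrm{rad}}^2>nN$. Its rate is $R(\mathcal{C})=\limsup_{K\to\infty}\frac1n\ln\frac{|\mathcal{C}\cap K\mathcal{A}|}{\mathrm{vol}(K\mathcal{A})}$, where $\mathcal{A}$ is an arbitrary centrally symmetric connected compact set in $\mathbb{R}^n$ with nonempty interior (e.g. the unit ball). $\overline{C}_{L-1}(N)=\limsup_{n\to\infty}\sup R(\mathcal{C})$ over all such codes in $\mathbb{R}^n$. *)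

(* Defs.v *)
From HB Require Import structures.
From mathcomp Require Import all_boot all_order all_algebra.
From mathcomp Require Import all_classical all_reals all_analysis.
Set Implicit Arguments. Unset Strict Implicit. Unset Printing Implicit Defensive.
Import Order.TTheory GRing.Theory Num.Def Num.Theory.
Import numFieldTopology.Exports numFieldNormedType.Exports.
Local Open Scope classical_set_scope.
Local Open Scope ring_scope.

Section Codes.
Variable R : realType.

Definition sqnorm n (x : 'rV[R]_n) : R := \sum_(i < n) (x ord0 i) ^+ 2.

Definition centroid n L (x : 'I_L -> 'rV[R]_n) : 'rV[R]_n :=
  L%:R^-1 *: \sum_(i < L) x i.

Definition avg_rad2 n L (x : 'I_L -> 'rV[R]_n) : R :=
  L%:R^-1 * \sum_(i < L) sqnorm (x i - centroid x).

(* (N, L-1)-average-radius list-decodable code: every L distinct points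
   of C have average squared radius > n N *)
Definition avg_rad_list_decodable n (N : R) (L : nat) (C : set 'rV[R]_n) :=
  forall x : 'I_L -> 'rV[R]_n, injective x -> (forall i, C (x i)) ->
    n%:R * N < avg_rad2 x.

Definition box n (a b : 'rV[R]_n) : set 'rV[R]_n :=
  [set x | forall i, a ord0 i <= x ord0 i <= b ord0 i].
Definition box_vol n (a b : 'rV[R]_n) : R :=
  \prod_(i < n) maxr 0 (b ord0 i - a ord0 i).

(* a countable family of boxes; [None] stands for "no box" (so that finite
   families are included); its covered set and total volume *)
Definition obox n (c : option ('rV[R]_n * 'rV[R]_n)) : set 'rV[R]_n :=
  if c is Some ab then box ab.1 ab.2 else set0.
Definition obox_vol n (c : option ('rV[R]_n * 'rV[R]_n)) : R :=
  if c is Some ab then box_vol ab.1 ab.2 else 0.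

Definition vol n (S : set 'rV[R]_n) : \bar R :=
  ereal_inf [set v | exists c : nat -> option ('rV[R]_n * 'rV[R]_n),
     S `<=` \bigcup_k obox (c k) /\
     v = (\sum_(0 <= k <oo) (obox_vol (c k))%:E)%E].

Definition dilate n (K : R) (A : set 'rV[R]_n) : set 'rV[R]_n :=
  [set K *: a | a in A].

Definition eln (x : \bar R) : \bar R :=
  match x with
  | r%:E => if (0 < r)%R then (ln r)%:E else -oo
  | +oo => +oo
  | -oo => -oo
  end%E.

Definition density n (A C : set 'rV[R]_n) (K : R) : \bar R :=
  let c := @counting _ R (C `&` dilate K A) in
  if c is +oo%E then +oo%E else (fine c / fine (vol (dilate K A)))%:E.

Definition rate n (A C : set 'rV[R]_n) : \bar R :=
  let f := fun K : R => (((n%:R)^-1)%:E * eln (density A C K))%E in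
  ereal_inf [set ereal_sup [set f K | K in [set K | M <= K]] | M in [set: R]].

Definition admissible_shape n (A : set 'rV[R]_n) : Prop :=
  (forall x, A x -> A (- x)) /\ connected A /\ compact A /\ (interior A !=set0).

Definition avg_rad_capacity (A : forall n, set 'rV[R]_n) (N : R) (L : nat) : \bar R :=
  limn_esup (fun n => ereal_sup
    [set rate (A n) C | C in [set C | avg_rad_list_decodable N L C]]).

End Codes.

(* Main.v *)
Require Import Defs.
From HB Require Import structures.
From mathcomp Require Import all_boot all_order all_algebra.
From mathcomp Require Import all_classical all_reals all_analysis.
From mathcomp Require Import measurable_realfun lra ring.
Import Order.TTheory GRing.Theory Num.Def Num.Theory.
Import numFieldTopology.Exports numFieldNormedType.Exports.
Local Open Scope classical_set_scope.
Local Open Scope ring_scope.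

(* A Gilbert-type packing argument.  The sum of the squared distances of
   [L] points to their centroid is [1/(2L)] times the sum of their pairwise
   squared distances, so a set whose distinct points are at squared distance
   more than [2LnN/(L-1)] is list-decodable.  Maximality of such a packing makes
   closed balls of squared radius [n * D], [D = 2LN/(L-1)], cover, and these have
   volume at most [(2 pi e D)^(n/2)] by a Gaussian Chernoff bound; the resulting
   rate is [-ln (sqrt (2 pi e D))] in every dimension [n > 0]. *)

Set Implicit Arguments. Unset Strict Implicit. Unset Printing Implicit Defensive.

(** * Integration over box covers *)

(* By induction on the dimension, integrating out one coordinate at a time;
   the weights [w] absorb the sides already integrated. *)
Lemma weighted_box_cover_ge (R : realType) (n : nat) (u : nat -> R) (s c : R)
    (lo hi : nat -> nat -> R) (w : nat -> R) :
  0 <= s -> 0 <= c -> (forall k, 0 <= w k) ->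
  (forall x : nat -> R, (forall i, u i <= x i <= u i + s) ->
     (c%:E <= \sum_(0 <= k <oo)
        (w k * \prod_(i < n) (lo k i <= x i <= hi k i)%R%:R)%:E)%E) ->
  ((c * s ^+ n)%:E <= \sum_(0 <= k <oo)
     (w k * \prod_(i < n) maxr 0 (hi k i - lo k i))%:E)%E.
Proof.
elim: n c w => [|n IHn] c w s0 c0 w0 cw.
  (* In dimension 0 the products are empty, and evaluating the hypothesis at the corner [u] of the
     cube suffices. *)
  have := cw u (fun i => _).
  rewrite expr0 mulr1.
  under eq_eseriesr do rewrite big_ord0.
  under [X in _ -> (_ <= X)%E]eq_eseriesr do rewrite big_ord0.
  by apply => i; rewrite lexx lerDl.
pose v k := maxr 0 (hi k n - lo k n) * w k.
have maxge0 k i : 0 <= maxr 0 (hi k i - lo k i) by rewrite le_max lexx.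
rewrite exprS mulrA (eq_eseriesr (g := fun k =>
  (v k * \prod_(i < n) maxr 0 (hi k i - lo k i))%:E)); last first.
  by move=> k _; rewrite big_ord_recr/= mulrA mulrC mulrA.
apply: IHn => // [|k|x xu]; [exact: mulr_ge0|exact: mulr_ge0|].
pose p k : R := w k * \prod_(i < n) (lo k i <= x i <= hi k i)%R%:R.
have p0 k : 0 <= p k by rewrite mulr_ge0// prodr_ge0.
pose D : set R := `[u n, u n + s]%classic.
have mD : measurable D by exact: measurable_itv.
have muD : lebesgue_measure D = s%:E.
  rewrite lebesgue_measure_itv /= lte_fin ltrDl -EFinB addrAC subrr add0r.
  by case: ltgtP s0 => // <-.
pose B k : set R := `[lo k n, hi k n]%classic.
have mB k : measurable (B k) by exact: measurable_itv.
have muB k : lebesgue_measure (B k) = (maxr 0 (hi k n - lo k n))%:E.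
  rewrite lebesgue_measure_itv /= lte_fin -EFinB.
  by case: ltP => h; congr EFin; [rewrite max_r// subr_ge0 ltW|
    rewrite max_l// subr_le0].
have -> : (c * s)%:E = (\int[lebesgue_measure]_(t in D) c%:E)%E.
  rewrite integral_cst// EFinM; congr mule; exact/esym.
have mIB k : measurable_fun D (fun t => (\1_(B k) t : R)%:E).
  by apply/measurable_EFinP; exact: measurable_indic.
have mpB k : measurable_fun D (fun t => (p k * \1_(B k) t)%:E).
  apply/measurable_EFinP; apply: measurable_funM; first exact: measurable_cst.
  exact: measurable_indic.
apply: (@le_trans _ _
  (\int[lebesgue_measure]_(t in D) \sum_(0 <= k <oo) (p k * \1_(B k) t)%:E)%E).
  apply: ge0_le_integral => //.
  - apply: ge0_emeasurable_sum => [k t _ _|k _].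
      by rewrite lee_fin mulr_ge0.
    exact: mpB.
  (* The hypothesis is used at [x] with coordinate [n] replaced by the integration variable [t]. *)
  - move=> t Dt; have := cw (fun i => if i == n then t else x i).
    move=> /(_ _)/le_trans; apply.
      move=> i; case: eqP => [->|_]; last exact: xu.
      by move: Dt; rewrite /D /= in_itv.
    apply: lee_nneseries => [k _ _|k _].
      by rewrite lee_fin mulr_ge0// prodr_ge0.
    rewrite lee_fin big_ord_recr/= eqxx /p -mulrA ler_wpM2l//.
    rewrite indicE ler_pM// ?prodr_ge0//.
      apply: ler_prod => i _; rewrite ler0n /=.
      by rewrite ltn_eqF// ltn_ord.
    by rewrite mem_setE in_itv.
(* By monotone convergence sum and integral commute; each term then integrates to [p k] times the
   length of [B k] inside [D], at most the side of box [k]. *)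
rewrite integral_nneseries //; last by move=> k t _; rewrite lee_fin mulr_ge0.
apply: lee_nneseries => [k _ _|k _].
  by apply: integral_ge0 => t _; rewrite lee_fin mulr_ge0.
under eq_integral do rewrite EFinM.
rewrite ge0_integralZl_EFin//; last exact: mIB.
rewrite integral_indic//; last exact: mB.
have -> : v k * \prod_(i < n) (lo k i <= x i <= hi k i)%R%:R =
    p k * maxr 0 (hi k n - lo k n) by rewrite /v -mulrA mulrC.
rewrite [X in (_ <= X)%E]EFinM lee_wpmul2l ?lee_fin// -muB.
apply: le_measure; rewrite ?inE; [|exact: mB|exact: subIsetl].
exact: (measurableI _ _ (mB k) mD).
Qed.

(** * Gaussian bound for covering a ball by boxes *)

(** The Gaussian decreases on the half-line, so each term with [k > 0] is at most the integral over
    the cell to its left, and these cells add up to at most the half-line integral [sqrtr pi / 2].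
    The term [k = 0] contributes the extra [h]. *)
Lemma gauss_riemann_sum_le (R : realType) (h : R) (m : nat) : 0 < h ->
  h * \sum_(k < m) gauss_fun (h * k%:R) <= h + sqrtr pi / 2.
Proof.
move=> h0.
have gauss_ge0 x : (0 <= (gauss_fun x : R)%:E)%E by rewrite lee_fin gauss_fun_ge0.
have mgauss (A : set R) : measurable_fun A (fun x : R => (gauss_fun x)%:E).
  apply/measurable_EFinP; apply: measurable_funTS.
  exact: measurable_gauss_fun.
have step p : ((h * \sum_(k < p) gauss_fun (h * k.+1%:R))%:E <=
    \int[lebesgue_measure]_(x in `[0%R, (h * p%:R)%R[) (gauss_fun x)%:E)%E.
  elim: p => [|p IHp]; first by rewrite big_ord0 mulr0 integral_ge0.
  have hp : h * p%:R <= h * p.+1%:R by rewrite ler_wpM2l ?ler_nat// ltW.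
  have hp0 : 0 <= h * p%:R by rewrite mulr_ge0// ltW.
  have -> : (`[0, h * p.+1%:R[%classic : set R) =
      `[0, h * p%:R[%classic `|` `[h * p%:R, h * p.+1%:R[%classic.
    by rewrite -itv_bndbnd_setU// bnd_simp.
  rewrite ge0_integral_setU//=; last first.
    apply/disj_setPS => x [] /=; rewrite !in_itv/= => /andP[_ a] /andP[b _].
    by move: (lt_le_trans a b); rewrite ltxx.
    exact: mgauss.
  rewrite big_ord_recr/= mulrDr EFinD leeD//.
  apply: (@le_trans _ _ (\int[lebesgue_measure]_(x in `[(h * p%:R)%R, (h * p.+1%:R)%R[)
     (gauss_fun (h * p.+1%:R))%:E)%E).
    rewrite integral_cst//= lebesgue_measure_itv/= lte_fin ltr_pM2l// ltr_nat.
    by rewrite ltnSn -EFinB -mulrBr -natrB// subSnn mulr1 -EFinM mulrC.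
  apply: ge0_le_integral => //; first exact: mgauss.
  move=> x /=; rewrite in_itv/= => /andP[px xp].
  have x0 := le_trans hp0 px.
  by rewrite lee_fin ler_expR lerN2 ler_pXn2r ?nnegrE ?(le_trans x0)// ltW.
case: m => [|m]; first by rewrite big_ord0 mulr0 addr_ge0// ?ltW// divr_ge0// sqrtr_ge0.
rewrite big_ord_recl mulr0 mulrDr lerD//.
  by rewrite /gauss_fun expr0n/= oppr0 expR0 mulr1.
rewrite -lee_fin -integral0y_gauss; apply: le_trans (step m) _.
apply: ge0_subset_integral => //=; first exact: mgauss.
by move=> x /=; rewrite !in_itv/= => /andP[-> _].
Qed.

(* Cover the ball by a grid of cubes of side [d]; the number of cubes is
   estimated by the Chernoff bound with the Gaussian weight [exp(-|x|^2/2D)],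
   whose sum over the grid factors over the coordinates. *)
Lemma ball_box_cover (R : realType) (n : nat) (D q : R) :
  0 < D -> sqrtr (2 * pi * expR 1 * D) < q ->
  exists l : seq ('rV[R]_n * 'rV[R]_n),
    (forall y, sqnorm y <= n%:R * D -> exists2 ab, ab \in l & box ab.1 ab.2 y) /\
    \sum_(ab <- l) box_vol ab.1 ab.2 <= q ^+ n.
Proof.
move=> D0 qD.
pose kap : R := expR 2^-1 * sqrtr (2 * D).
have kap0 : 0 < kap by rewrite mulr_gt0// ?expR_gt0// sqrtr_gt0 mulr_gt0.
have kapE : sqrtr (2 * pi * expR 1 * D) = kap * sqrtr pi.
  have -> : 2 * pi * expR 1 * D = (2 * D) * pi * expR 2^-1 ^+ 2 :> R.
    by rewrite -expRM_natl mulfV//; ring.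
  rewrite sqrtrM ?mulr_ge0 ?pi_ge0 ?ltW// sqrtr_sqr ger0_norm ?expR_ge0//.
  by rewrite sqrtrM ?mulr_ge0 ?ltW// /kap; ring.
(* The mesh [h] is chosen so that the Riemann sum error, [h] for each of the two signs, uses up
   exactly the slack in [q]. *)
have [h h0 qE] : exists2 h, 0 < h & q = kap * (2 * h + sqrtr pi).
  exists ((q / kap - sqrtr pi) / 2); last by field; rewrite gt_eqF.
  by rewrite divr_gt0// subr_gt0 ltr_pdivlMr// mulrC -kapE.
pose sD := sqrtr (2 * D).
have sD0 : 0 < sD by rewrite sqrtr_gt0 mulr_gt0.
have sDE : sD ^+ 2 = 2 * D by rewrite sqr_sqrtr// mulr_ge0// ltW.
(* With this side the weight [exp(-(d k)^2 / 2D)] is [gauss_fun (h * k)]. *)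
pose d := h * sD.
have d0 : 0 < d by rewrite mulr_gt0.
pose m := (truncn (sqrtr (n%:R * D) / d)).+1.
(* A cell is given per coordinate by a distance index and a sign ([true] for nonnegative), so its
   corner nearest to the origin has coordinates [d * k] up to sign. [P] keeps the cells whose
   nearest corner lies in the ball. *)
pose I := {ffun 'I_n -> 'I_m * bool}.
pose lo (f : I) : 'rV[R]_n := \row_i
  (if (f i).2 then d * (f i).1%:R else - (d * (f i).1.+1%:R)).
pose hi (f : I) : 'rV[R]_n := \row_i
  (if (f i).2 then d * (f i).1.+1%:R else - (d * (f i).1%:R)).
pose P (f : I) := \sum_i (d * (f i).1%:R) ^+ 2 <= n%:R * D.
exists [seq (lo f, hi f) | f <- enum I & P f]; split.
  move=> y yD.
  have yi i : `|y ord0 i| <= sqrtr (n%:R * D).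
    rewrite -sqrtr_sqr ler_wsqrtr//; apply: le_trans yD.
    rewrite /sqnorm (bigD1 i)//= lerDl; apply: sumr_ge0 => j _; exact: sqr_ge0.
  have kP i : (truncn (`|y ord0 i| / d) < m)%N.
    by rewrite ltnS le_truncn// ler_pM2r ?invr_gt0.
  have kI i : d * (truncn (`|y ord0 i| / d))%:R <= `|y ord0 i| <=
      d * (truncn (`|y ord0 i| / d)).+1%:R.
    have /truncn_itv/andP[a b] : 0 <= `|y ord0 i| / d by rewrite divr_ge0// ltW.
    by rewrite !(mulrC d) -ler_pdivlMr// a -ler_pdivrMr// ltW.
  pose f : I := [ffun i => (Ordinal (kP i), 0 <= y ord0 i)].
  exists (lo f, hi f).
    apply/mapP; exists f => //; rewrite mem_filter mem_enum andbT.
    rewrite /P (le_trans _ yD)// /sqnorm; apply: ler_sum => i _.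
    rewrite ffunE/= -[leRHS]real_normK ?num_real//.
    have /andP[a _] := kI i.
    by rewrite ler_pXn2r// nnegrE mulr_ge0// ltW.
  move=> i; rewrite !mxE !ffunE/=; have := kI i.
  case: (ger0P (y ord0 i)) => [y0|y0 /andP[a b]].
    by [].
  by rewrite lerNl b lerNr a.
rewrite big_map big_filter.
pose g k : R := d * gauss_fun (h * k%:R).
have gE (f : I) : box_vol (lo f) (hi f) = d ^+ n.
  rewrite /box_vol -[n in RHS]card_ord -prodr_const; apply: eq_bigr => i _.
  rewrite !mxE; case: ifP => _; rewrite -[X in maxr 0 X](_ : d = _) ?max_r ?ltW//.
    by rewrite -mulrBr -natrB// subSnn mulr1.
  by rewrite opprK addrC -mulrBr -natrB// subSnn mulr1.
(* Chernoff step: under [P] the product of the weights is at least [exp(-n/2)], so after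
   multiplication by [exp(n/2)] each kept cell counts at least its volume; the other cells only add
   nonnegative terms. *)
apply: (@le_trans _ _ (expR 2^-1 ^+ n * \sum_(f : I) \prod_i g (f i).1)).
  rewrite mulr_sumr big_enum_cond/= big_mkcond; apply: ler_sum => f _.
  have gp : 0 <= \prod_i g (f i).1.
    by apply: prodr_ge0 => i _; rewrite mulr_ge0 ?gauss_fun_ge0// ltW.
  case: ifP => [Pf|_]; last by rewrite mulr_ge0// exprn_ge0// expR_ge0.
  rewrite gE /g big_split/= prodr_const card_ord mulrCA ler_peMr ?exprn_ge0 ?(ltW d0)//.
  rewrite -expRM_natl /gauss_fun -expR_sum -expRD -[leLHS]expR0 ler_expR.
  rewrite sumrN subr_ge0 -(@ler_pM2l _ (2 * D)) ?mulr_gt0//.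
  have -> : 2 * D * (n%:R * 2^-1) = n%:R * D by field.
  apply: le_trans Pf; rewrite mulr_sumr; apply: ler_sum => i _.
  by rewrite -sDE /d !exprMn; lra.
rewrite -(bigA_distr_bigA (fun _ (p : 'I_m * bool) => g p.1)) /=.
rewrite prodr_const card_ord -exprMn; apply: lerXn2r.
- by rewrite nnegrE mulr_ge0 ?expR_ge0// sumr_ge0// => p _; rewrite mulr_ge0 ?gauss_fun_ge0// ltW.
- by rewrite nnegrE (le_trans _ (ltW qD))// sqrtr_ge0.
have -> : \sum_(p : 'I_m * bool) g p.1 = 2 * sD * (h * \sum_(k < m) gauss_fun (h * k%:R)).
  rewrite -(pair_bigA _ (fun (k : 'I_m) (b : bool) => g k))/=.
  under eq_bigr do rewrite sumr_const card_bool.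
  rewrite sumrMnl -[RHS]mulrA -[LHS]mulr_natl; congr (_ * _).
  by rewrite mulrA [sD * h]mulrC mulr_sumr.
rewrite qE /kap -/sD -!mulrA ler_pM2l ?expR_gt0// mulrCA ler_pM2l//.
have := @gauss_riemann_sum_le R h m h0; lra.
Qed.

(** * Volume estimates for covers, cubes and dilates *)

Lemma box_vol_ge0 (R : realType) (n : nat) (a b : 'rV[R]_n) : 0 <= box_vol a b.
Proof. by apply: prodr_ge0 => i _; rewrite le_max lexx. Qed.

Lemma obox_vol_ge0 (R : realType) (n : nat) (c : option ('rV[R]_n * 'rV[R]_n)) :
  0 <= obox_vol c.
Proof. by case: c => [ab|]//=; exact: box_vol_ge0. Qed.

Lemma vol_le_sum (R : realType) (n : nat) (S : set 'rV[R]_n)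
    (l : seq ('rV[R]_n * 'rV[R]_n)) :
  (forall x, S x -> exists2 ab, ab \in l & box ab.1 ab.2 x) ->
  (vol S <= (\sum_(ab <- l) box_vol ab.1 ab.2)%:E)%E.
Proof.
move=> Sl; apply: ereal_inf_lbound; exists (nth None (map Some l)); split.
  move=> x /Sl[ab abl xab]; exists (index ab l) => //=.
  by rewrite (nth_map ab) ?index_mem// nth_index.
rewrite (nneseries_split 0 (size l)); last first.
  by move=> k _; rewrite lee_fin obox_vol_ge0.
rewrite [X in (_ + X)%E]eseries0 ?adde0; last first.
  by move=> k lk _; rewrite nth_default ?size_map.
rewrite add0n sumEFin; congr EFin.
elim: l {Sl} => [|ab l IHl]; first by rewrite big_nil big_geq.
by rewrite big_cons IHl /= big_nat_recl.
Qed.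

(** The indicators of any box cover of [S] sum to at least 1 on the cube, and
    [weighted_box_cover_ge] integrates this inequality. *)
Lemma vol_ge_cube (R : realType) (n : nat) (S : set 'rV[R]_n) (a : 'rV[R]_n)
    (s : R) : 0 <= s ->
  (forall x : 'rV[R]_n, (forall i, a ord0 i <= x ord0 i <= a ord0 i + s) -> S x) ->
  ((s ^+ n)%:E <= vol S)%E.
Proof.
move=> s0 aS; apply: le_ereal_inf_tmp => _ [c [Sc ->]].
(* Coordinates are extended by 0 to all natural indices; a missing box becomes the point box at 0
   with weight 0. *)
pose coord (v : 'rV[R]_n) (j : nat) := if insub j is Some i then v ord0 i else 0.
have coordE v (i : 'I_n) : coord v i = v ord0 i by rewrite /coord valK.
pose lo k := coord (if c k is Some ab then ab.1 else 0).
pose hi k := coord (if c k is Some ab then ab.2 else 0).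
pose w k : R := (c k != None)%:R.
have w0 k : 0 <= w k by [].
have := @weighted_box_cover_ge R n (coord a) s 1 lo hi w s0 ler01 w0.
rewrite mul1r => /(_ _)/le_trans; apply; last first.
  apply: lee_nneseries => [k _ _|k _].
    by rewrite lee_fin mulr_ge0// prodr_ge0// => i _; rewrite le_max lexx.
  rewrite lee_fin /w /obox_vol /lo /hi; case: (c k) => [ab|]; last by rewrite mul0r.
  by rewrite mul1r; apply: ler_prod => i _; rewrite !coordE lexx andbT le_max lexx.
move=> x ax.
have /Sc[k _] : S (\row_i x i).
  by apply: aS => i; rewrite mxE; have := ax i; rewrite coordE.
case ck : (c k) => [ab|]//= abx.
apply: (@le_trans _ _ (\sum_(0 <= j < k.+1)
   (w j * \prod_(i < n) (lo j i <= x i <= hi j i)%R%:R)%:E)%E); last first.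
  by apply: nneseries_lim_ge => j _ _; rewrite lee_fin mulr_ge0// prodr_ge0.
rewrite sumEFin lee_fin big_nat_recr//= ler_wpDl//.
  by apply: sumr_ge0 => j _; rewrite mulr_ge0// prodr_ge0.
rewrite /w ck mul1r big1// => i _.
by rewrite /lo /hi !coordE ck; have := abx i; rewrite mxE => ->.
Qed.

(** An interior ball contains a cube, which scales with [K]. Since [s] does not depend on [K],
    dilates get arbitrarily large volume in positive dimension. *)
Lemma vol_dilate_ge (R : realType) (n : nat) (A : set 'rV[R]_n) :
  interior A !=set0 ->
  exists2 s : R, 0 < s & forall K, 0 < K -> (((K * s) ^+ n)%:E <= vol (dilate K A))%E.
Proof.
move=> [p /nbhs_ballP[e /= e0 pA]]; exists (e / 2); first by rewrite divr_gt0.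
move=> K K0; apply: (@vol_ge_cube _ _ _ (K *: p)); first by rewrite mulr_ge0 ?divr_ge0 ?ltW.
move=> x xp; exists (K^-1 *: x); last by rewrite scalerA divff ?gt_eqF// scale1r.
apply: pA; split=> // i j; rewrite (ord1 i) mxE; have := xp j; rewrite mxE.
rewrite -mulrDr -{1 2}[x ord0 j](mulVKf (lt0r_neq0 K0)) !ler_pM2l//.
by rewrite /ball/= ltr_distlC => /andP[a b]; apply/andP; split; lra.
Qed.

Lemma dilate_bounded (R : realType) (n : nat) (A : set 'rV[R]_n) (K : R) :
  compact A -> exists r, forall x, dilate K A x -> forall i, `|x ord0 i| <= r.
Proof.
move=> /compact_bounded [M [_ /(_ (M + 1) (ltr_pwDr ltr01 (lexx M))) AM]].
exists (`|K| * (M + 1)) => _ [x Ax <-] i.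
rewrite mxE normrM ler_wpM2l//; apply: le_trans (AM _ Ax).
rewrite [leRHS]mx_normrE.
exact: (le_bigmax _ (fun ij : 'I_1 * 'I_n => `|x ij.1 ij.2|) (ord0, i)).
Qed.

(** * Separated sets and finite packings *)

Definition sqdist_separated (R : realType) (n : nat) (D : R) (C : set 'rV[R]_n) :=
  forall x y, C x -> C y -> x != y -> D < sqnorm (x - y).

Lemma sqnormN (R : realType) (n : nat) (x : 'rV[R]_n) : sqnorm (- x) = sqnorm x.
Proof. by apply: eq_bigr => i _; rewrite mxE sqrrN. Qed.

(** Pigeonhole on a grid of side [sqrtr (D / n.+1%:R)]: two points in one cell are at squared
    distance at most [n * D / (n + 1) <= D]. The [n.+1] keeps the side meaningful for [n = 0]. *)
Lemma separated_size_le (R : realType) (n : nat) (D r : R) : 0 < D ->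
  exists M, forall s : seq 'rV[R]_n, uniq s -> sqdist_separated D [set` s] ->
    (forall x, x \in s -> forall i, `|x ord0 i| <= r) -> (size s <= M)%N.
Proof.
move=> D0; pose e := sqrtr (D / n.+1%:R).
have e0 : 0 < e by rewrite sqrtr_gt0 divr_gt0.
pose m := truncn ((r + r) / e).
pose cell (x : 'rV[R]_n) : {ffun 'I_n -> 'I_m.+1} :=
  [ffun i => inord (truncn ((x ord0 i + r) / e))].
exists #|{ffun 'I_n -> 'I_m.+1}| => s us seps sr.
rewrite -(size_map cell) -(card_uniqP _) ?max_card// map_inj_in_uniq//.
move=> x y xs ys /ffunP cxy; apply/eqP/negPn/negP => /(seps _ _ xs ys).
apply/negP; rewrite -leNgt.
have xr z : z \in s -> forall i, (truncn ((z ord0 i + r) / e) < m.+1)%N /\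
    0 <= (z ord0 i + r) / e.
  move=> /sr zr i; have := zr i; rewrite ler_norml => /andP[a b]; split.
    by rewrite ltnS le_truncn// ler_pM2r ?invr_gt0// lerD2r.
  by rewrite divr_ge0 ?(ltW e0)// -lerBlDr sub0r.
apply: (@le_trans _ _ (\sum_(i < n) D / n.+1%:R)); last first.
  rewrite sumr_const card_ord -mulrnAr -mulr_natl ler_piMr ?(ltW D0)//.
  by rewrite ler_pdivrMr// mul1r ler_nat.
apply: ler_sum => i _; rewrite !mxE.
have -> : D / n.+1%:R = e ^+ 2 by rewrite sqr_sqrtr// divr_ge0 ?ltW.
have [xm x0] := xr x xs i; have [ym y0] := xr y ys i.
have := cxy i; rewrite !ffunE => /(congr1 val); rewrite /= !inordK// => xyE.
have /andP[a b] := truncn_itv x0; have /andP[c d] := truncn_itv y0.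
rewrite xyE in a b.
move: a b c d; move: (truncn _) => k; rewrite !ler_pdivlMr// !ltr_pdivrMr// -natr1 mulrDl mul1r.
move=> a b c d; rewrite -real_normK ?num_real// lerXn2r ?nnegrE ?(ltW e0)//.
by rewrite ler_norml; apply/andP; split; lra.
Qed.

(** Greedy choice: while some point of [S] is uncovered it can be added to [G], and the size bound
    for separated sets stops the process. The earlier points [F] may lie outside [S]. *)
Lemma separated_extend (R : realType) (n : nat) (D r : R) (S : set 'rV[R]_n)
    (F : seq 'rV[R]_n) : 0 < D ->
  (forall x, S x -> forall i, `|x ord0 i| <= r) -> sqdist_separated D [set` F] ->
  exists G : seq 'rV[R]_n, [/\ uniq G, (forall x, x \in G -> S x),
    sqdist_separated D [set` G ++ F] &
    forall x, S x -> exists2 y, y \in G ++ F & sqnorm (x - y) <= D].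
Proof.
move=> D0 Sr sepF; have [M sizeM] := @separated_size_le R n D r D0.
pose good G := [/\ uniq G, (forall x, x \in G -> S x) &
  sqdist_separated D [set` G ++ F]].
pose covers G := forall x, S x ->
  exists2 y, y \in G ++ F & sqnorm (x - y) <= D.
have grow G : good G -> ~ covers G -> exists x, good (x :: G).
  move=> [uG GS sepG] /existsNP[x /not_implyP[Sx xG]].
  have xfar y : y \in G ++ F -> D < sqnorm (x - y).
    by move=> yG; rewrite ltNge; apply/negP => xy; apply: xG; exists y.
  exists x; split.
  - rewrite /= uG andbT; apply/negP => xG'.
    have := xfar x; rewrite mem_cat xG' subrr => /(_ isT).
    rewrite /sqnorm big1 => [|i _]; last by rewrite mxE expr0n.
    by rewrite ltNge (ltW D0).
  - by move=> y; rewrite inE => /predU1P[->//|]; exact: GS.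
  - move=> y z /=; rewrite !inE => /predU1P[->|yG] /predU1P[->|zG] yz.
    + by rewrite eqxx in yz.
    + exact: xfar.
    + by rewrite -sqnormN opprB; exact: xfar.
    + exact: sepG.
(* Induction on [k], a bound on how many points can still be added. *)
suff H k G : (M <= size G + k)%N -> good G -> exists G, good G /\ covers G.
  have [//||G [[? ? ?] ?]] := H M [::]; last by exists G.
  by split.
elim: k G => [|k IHk] G MG gG;
  (have [cov|/(grow _ gG)[x gx]] := pselect (covers G); first by exists G).
  have [ux xS sepx] := gx.
  suff: (size (x :: G) <= M)%N by rewrite /= ltnNge -[size G]addn0 MG.
  apply: sizeM => // [y z yG zG|y /xS Sy]; last exact: Sr.
  have sub u : u \in x :: G -> u \in (x :: G) ++ F by rewrite mem_cat => ->.
  by apply: sepx; exact: sub.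
by apply: IHk gx; rewrite /= addSnnS.
Qed.

Lemma box_vol_translate (R : realType) (n : nat) (y a b : 'rV[R]_n) :
  box_vol (y + a) (y + b) = box_vol a b.
Proof. by apply: eq_bigr => i _; rewrite !mxE opprD addrACA subrr add0r. Qed.

Lemma vol_le_packing (R : realType) (n : nat) (D : R) (S : set 'rV[R]_n)
    (l : seq ('rV[R]_n * 'rV[R]_n)) (G : seq 'rV[R]_n) :
  (forall y, sqnorm y <= D -> exists2 ab, ab \in l & box ab.1 ab.2 y) ->
  (forall x, S x -> exists2 y, y \in G & sqnorm (x - y) <= D) ->
  (vol S <= ((size G)%:R * \sum_(ab <- l) box_vol ab.1 ab.2)%:E)%E.
Proof.
move=> lD GS.
pose tr (y : 'rV[R]_n) (ab : 'rV[R]_n * 'rV[R]_n) := (y + ab.1, y + ab.2).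
apply: (@le_trans _ _
    (\sum_(ab <- [seq tr y ab | y <- G, ab <- l]) box_vol ab.1 ab.2)%:E).
  apply: vol_le_sum => x /GS[y yG /lD[ab abl xab]].
  exists (tr y ab); first exact: allpairs_f.
  by move=> i; have := xab i; rewrite !mxE lerBrDl lerBlDl.
rewrite lee_fin big_allpairs_dep/= mulr_natl.
under eq_bigr => y _ do under eq_bigr => ab _ do rewrite box_vol_translate.
by rewrite big_const_seq count_predT iter_addr_0.
Qed.

(** Covering gives [v <= (size G + size F) * W]. For large [K] the old points account for at most
    the fraction [1 - W / Q] of [v], so replacing [W] by [Q] lets [G] alone carry the bound. *)
Lemma packing_step (R : realType) (n : nat) (A : set 'rV[R]_n) (D W Q : R)
    (l : seq ('rV[R]_n * 'rV[R]_n)) (F : seq 'rV[R]_n) (M : R) :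
  (0 < n)%N -> 0 < D -> compact A -> interior A !=set0 ->
  (forall y, sqnorm y <= D -> exists2 ab, ab \in l & box ab.1 ab.2 y) ->
  \sum_(ab <- l) box_vol ab.1 ab.2 <= W -> 0 < W < Q -> sqdist_separated D [set` F] ->
  exists K G v, [/\ M <= K, uniq G, (forall x, x \in G -> dilate K A x),
    sqdist_separated D [set` G ++ F] &
    [/\ 0 < v, vol (dilate K A) = v%:E & v <= (size G)%:R * Q]].
Proof.
move=> n0 D0 cA iA lD lW /andP[W0 WQ] sepF.
have [s s0 sA] := vol_dilate_ge iA.
(* The second entry makes [size F * W <= v * (1 - W / Q)]; the 1 ensures [K * s <= (K * s) ^+ n]. *)
pose T := Num.max 1 ((size F)%:R * W * Q / (Q - W)).
have T1 : 1 <= T by rewrite le_max lexx.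
pose K := Num.max M (T / s).
have KT : T <= K * s by rewrite -ler_pdivrMr// le_max lexx orbT.
have K0 : 0 < K by rewrite lt_max divr_gt0 ?orbT// (lt_le_trans ltr01).
have [r Ar] := dilate_bounded K cA.
have [G [uG GA sepG cov]] := separated_extend D0 Ar sepF.
have volle : (vol (dilate K A) <= ((size (G ++ F))%:R * W)%:E)%E.
  apply: le_trans (vol_le_packing lD cov) _.
  by rewrite lee_fin ler_wpM2l.
have volge : (T%:E <= vol (dilate K A))%E.
  apply: le_trans (sA _ K0); rewrite lee_fin (le_trans KT)//.
  by rewrite ler_eXnr// (le_trans T1).
case volE : (vol (dilate K A)) volle volge => [v| |]//.
rewrite !lee_fin => vle vge.
have v0 : 0 < v by rewrite (lt_le_trans _ vge)// (lt_le_trans ltr01).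
exists K, G, v; split=> //; first by rewrite le_max lexx.
split=> //.
have : (size F)%:R * W * Q <= v * (Q - W).
  by rewrite -ler_pdivrMr ?subr_gt0//; apply: le_trans vge; rewrite le_max lexx orbT.
move: vle; rewrite size_cat natrD mulrDl -(ler_pM2r (lt_trans W0 WQ)).
rewrite -[v <= _](ler_pM2r W0); lra.
Qed.

(** * List decodability of separated sets *)

(** Write [y i - y j] as a difference of deviations from the mean [m]; the cross terms vanish
    because the deviations sum to zero. *)
Lemma sum_sqr_mean (R : realType) (L : nat) (y : 'I_L -> R) : (0 < L)%N ->
  \sum_i (y i - L%:R^-1 * \sum_j y j) ^+ 2 =
    (2 * L%:R)^-1 * \sum_i \sum_j (y i - y j) ^+ 2.
Proof.
move=> L0; have L0' : L%:R != 0 :> R by rewrite pnatr_eq0 -lt0n.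
set m := _^-1 * _.
have ym : \sum_j y j = L%:R * m by rewrite /m mulVKf.
have -> : \sum_i \sum_j (y i - y j) ^+ 2 =
    \sum_i (L%:R * (y i - m) ^+ 2 + \sum_j (y j - m) ^+ 2).
  apply: eq_bigr => i _.
  transitivity (\sum_j (((y i - m) ^+ 2 + (y j - m) ^+ 2) +
      (- (2 * (y i - m))) * (y j - m))).
    by apply: eq_bigr => j _; ring.
  rewrite big_split/= -mulr_sumr sumrB sumr_const card_ord ym -[m *+ L]mulr_natl subrr mulr0 addr0.
  by rewrite big_split/= sumr_const card_ord [in RHS]mulr_natl.
rewrite big_split/= sumr_const card_ord -mulr_sumr.
by rewrite -[X in _ + X]mulr_natl; field.
Qed.

Lemma avg_rad2E (R : realType) (n L : nat) (x : 'I_L -> 'rV[R]_n) : (0 < L)%N ->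
  avg_rad2 x = (2 * L%:R ^+ 2)^-1 * \sum_i \sum_j sqnorm (x i - x j).
Proof.
move=> L0; have L0' : L%:R != 0 :> R by rewrite pnatr_eq0 -lt0n.
transitivity (L%:R^-1 * \sum_(k < n)
    ((2 * L%:R)^-1 * \sum_i \sum_j (x i ord0 k - x j ord0 k) ^+ 2)).
  congr (_ * _); rewrite exchange_big/=; apply: eq_bigr => k _.
  rewrite -sum_sqr_mean//; apply: eq_bigr => i _.
  by rewrite !mxE summxE.
rewrite -mulr_sumr mulrA; congr (_ * _); first by field.
rewrite exchange_big/=; apply: eq_bigr => i _.
rewrite exchange_big/=; apply: eq_bigr => j _.
by apply: eq_bigr => k _; rewrite !mxE.
Qed.

(** The separation is the value at which the [L * (L - 1)] ordered pairs, weighted by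
    [1 / (2 * L ^ 2)], give exactly [n * N]. As [L >= 2] there is at least one pair, so the
    inequality is strict. *)
Lemma separated_list_decodable (R : realType) (n L : nat) (N : R)
    (C : set 'rV[R]_n) : (2 <= L)%N ->
  sqdist_separated (n%:R * (2 * L%:R * N / (L%:R - 1))) C -> avg_rad_list_decodable N L C.
Proof.
move=> L2 sepC x xI xC; have L0 : (0 < L)%N by exact: ltn_trans L2.
have L1 : 0 < L%:R - 1 :> R by rewrite subr_gt0 ltr1n.
have L0' : 0 < L%:R :> R by rewrite ltr0n.
rewrite avg_rad2E//; set D := _ * (_ / _) in sepC.
have DE : n%:R * N = (2 * L%:R ^+ 2)^-1 * \sum_(i < L) \sum_(j < L | j != i) D.
  under eq_bigr do rewrite sumr_const cardC1 card_ord.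
  rewrite sumr_const card_ord -mulrnA -[D *+ _]mulr_natr natrM -subn1 natrB// /D.
  by field; rewrite !gt_eqF.
rewrite DE ltr_pM2l ?invr_gt0 ?mulr_gt0 ?exprn_gt0//.
have sumE i : \sum_j sqnorm (x i - x j) = \sum_(j < L | j != i) sqnorm (x i - x j).
  rewrite (bigD1 i)//= subrr /sqnorm big1 ?add0r// => k _.
  by rewrite mxE expr0n.
apply: ltr_sum => [|i _]; first by apply/hasP; exists (Ordinal L0); rewrite ?mem_index_enum.
rewrite sumE; apply: ltr_sum => [|j ji]; last first.
  by apply: sepC => //; rewrite (inj_eq xI) eq_sym.
have [j ji] : exists j : 'I_L, j != i.
  have [->|] := eqVneq i (Ordinal L0); first by exists (Ordinal L2).
  by exists (Ordinal L0); rewrite eq_sym.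
by apply/hasP; exists j; rewrite ?mem_index_enum.
Qed.

(** * The code and its rate *)

(* The boundary of [A] may have positive volume, so a maximal separated subset
   of the whole space need not be dense enough inside [K *: A].  Instead the
   code is an increasing union of finite packings, each maximal in [K_j *: A],
   with [K_j] so large that the points chosen earlier are negligible. *)
Lemma exists_dense_packing (R : realType) (n : nat) (A : set 'rV[R]_n)
    (D W Q : R) (l : seq ('rV[R]_n * 'rV[R]_n)) :
  (0 < n)%N -> 0 < D -> compact A -> interior A !=set0 ->
  (forall y, sqnorm y <= D -> exists2 ab, ab \in l & box ab.1 ab.2 y) ->
  \sum_(ab <- l) box_vol ab.1 ab.2 <= W -> 0 < W < Q ->
  exists2 C : set 'rV[R]_n, sqdist_separated D C &
    forall M : R, exists K G v, [/\ M <= K, uniq G,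
      (forall x, x \in G -> (C `&` dilate K A) x) &
      [/\ 0 < v, vol (dilate K A) = v%:E & v <= (size G)%:R * Q]].
Proof.
move=> n0 D0 cA iA lD lW WQ.
(* States for dependent choice: a finite packing with its stage number, which bounds the next
   dilation factor from below. *)
pose X := {p : seq 'rV[R]_n * nat | sqdist_separated D [set` p.1]}.
pose next (p q : X) := (sval q).2 = (sval p).2.+1 /\
  exists K G v, [/\ (sval p).2%:R <= K, uniq G, (sval q).1 = G ++ (sval p).1,
    (forall x, x \in G -> dilate K A x) &
    [/\ 0 < v, vol (dilate K A) = v%:E & v <= (size G)%:R * Q]].
have nextP (p : X) : {q | next p q}.
  apply: cid; case: p => -[F j] /= sepF.
  have [K [G [v [MK uG GA sepG vG]]]] :=
    packing_step j%:R n0 D0 cA iA lD lW WQ sepF.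
  exists (exist _ (G ++ F, j.+1) sepG); split=> //.
  by exists K, G, v.
have sep0 : sqdist_separated D [set` ([::], 0%N).1 : seq 'rV[R]_n] by [].
have [f [f0 fS]] := dependent_choice nextP (exist _ ([::], 0%N) sep0).
have fj j : (sval (f j)).2 = j.
  by elim: j => [|j IHj]; [rewrite f0|have [-> _] := fS j; rewrite IHj].
have fsub i j : (i <= j)%N -> {subset (sval (f i)).1 <= (sval (f j)).1}.
  move=> /subnK <-; elim: (j - i)%N => [//|k IHk] x /IHk xk.
  by rewrite addSn; have [_ [K [G [v [_ _ -> _ _]]]]] := fS (k + i)%N; rewrite mem_cat xk orbT.
exists (\bigcup_j [set` (sval (f j)).1]).
  move=> x y [i _ xi] [j _ yj]; apply: (svalP (f (maxn i j))).
    by apply: fsub xi; rewrite leq_maxl.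
  by apply: fsub yj; rewrite leq_maxr.
move=> M; pose j := (truncn M).+1.
have [_ [K [G [v [jK uG fG GA vG]]]]] := fS j.
exists K, G, v; split=> //.
  by apply: le_trans jK; rewrite fj ltW// truncnS_gt.
move=> x xG; split; last exact: GA.
by exists j.+1 => //; rewrite /mkset fG mem_cat xG.
Qed.

Lemma size_le_counting (T : choiceType) (R : realType) (G : seq T) (S : set T) :
  uniq G -> (forall x, x \in G -> S x) ->
  ((size G)%:R%:E <= @counting _ R S)%E.
Proof.
move=> uG GS; rewrite /counting; case: asboolP => [fS|_]; last exact: leey.
rewrite lee_fin ler_nat uniq_leq_size// => x /GS Sx.
by rewrite in_fset_set//; exact: mem_set.
Qed.

Lemma eln_density_ge (R : realType) (n : nat) (A C : set 'rV[R]_n) (K v Q : R)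
    (G : seq 'rV[R]_n) : 0 < Q -> uniq G ->
  (forall x, x \in G -> (C `&` dilate K A) x) ->
  0 < v -> vol (dilate K A) = v%:E -> v <= (size G)%:R * Q ->
  ((- ln Q)%:E <= eln (density A C K))%E.
Proof.
move=> Q0 uG GC v0 volE vQ; rewrite /density volE.
have := size_le_counting R uG GC.
(* An infinite count gives density [+oo], whose logarithm is [+oo]. *)
case: (counting _) => [c|_|]; [|exact: leey|by rewrite leeNy_eq].
rewrite /=.
rewrite lee_fin => Gc; have cQ : Q^-1 <= c / v.
  rewrite ler_pdivlMr// ler_pdivrMl// mulrC (le_trans vQ)//.
  by rewrite ler_wpM2r// ltW.
have Q'0 : 0 < Q^-1 by rewrite invr_gt0.
rewrite (lt_le_trans Q'0 cQ) lee_fin -lnV ?posrE//.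
by rewrite ler_ln ?posrE// (lt_le_trans Q'0).
Qed.

Lemma exists_code_rate_ge (R : realType) (n L : nat) (N q : R) (A : set 'rV[R]_n) :
  (0 < n)%N -> 0 < N -> (2 <= L)%N -> compact A -> interior A !=set0 ->
  sqrtr (2 * pi * expR 1 * (2 * L%:R * N / (L%:R - 1))) < q ->
  exists2 C : set 'rV[R]_n, avg_rad_list_decodable N L C &
    ((- ln q)%:E <= rate A C)%E.
Proof.
move=> n0 N0 L2 cA iA; set D := _ / _ => Dq.
have L0 : 0 < L%:R :> R by rewrite ltr0n (ltn_trans _ L2).
have D0 : 0 < D by rewrite divr_gt0 ?mulr_gt0// subr_gt0 ltr1n.
(* The slack is split at the midpoint [p]: [p ^+ n] bounds the cover of the ball, and the gap up to
   [q ^+ n] absorbs the earlier points of the packing. *)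
have [Dp pq] := midf_lt Dq; set p := (_ / _) in Dp pq.
have p0 : 0 < p by rewrite (le_lt_trans _ Dp)// sqrtr_ge0.
have q0 := lt_trans p0 pq.
have [l [lD lp]] := ball_box_cover n D0 Dp.
have nD0 : 0 < n%:R * D by rewrite mulr_gt0// ltr0n.
have pqn : 0 < p ^+ n < q ^+ n.
  by rewrite exprn_gt0//= ltrXn2r ?nnegrE ?ltW// -lt0n.
have [C sepC dC] := exists_dense_packing n0 nD0 cA iA lD lp pqn.
exists C; first exact: separated_list_decodable.
apply: le_ereal_inf_tmp => _ [M _ <-].
have [K [G [v [MK uG GC [v0 volE vQ]]]]] := dC M.
apply: le_trans (ereal_sup_ubound _); last by exists K.
have n0' : 0 < n%:R :> R by rewrite ltr0n.
have -> : - ln q = n%:R^-1 * - ln (q ^+ n).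
  by rewrite lnXn// -[ln q *+ n]mulr_natl mulrN mulKf ?gt_eqF.
rewrite EFinM lee_wpmul2l ?lee_fin ?invr_ge0//.
by apply: eln_density_ge volE vQ; rewrite ?exprn_gt0.
Qed.

Unset Implicit Arguments. Set Strict Implicit. Set Printing Implicit Defensive.

Theorem mainTheorem13 (R : realType) (N : R) (L : nat)
    (A : forall n : nat, set 'rV[R]_n) :
  0 < N -> (2 <= L)%N ->
  (forall n : nat, admissible_shape (A n)) ->
  ((2^-1 * ln ((L%:R - 1) / (4 * pi * expR 1 * L%:R * N)))%:E
     <= avg_rad_capacity A N L)%E.
Proof.
move=> N0 L2 adA; set T := 2^-1 * _.
(* The limsup is an infimum, over neighbourhoods [V] of infinity, of suprema; dimension [k.+1] lies
   in [V] and is positive. *)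
apply: le_ereal_inf_tmp => _ [V [k _ kV] <-].
apply: le_trans (ereal_sup_ubound _); last first.
  by exists k.+1; first by apply: kV; exact: leqnSn.
have [_ [_ [cA iA]]] := adA k.+1.
apply/lee_addgt0Pr => e e0.
have L0 : 0 < L%:R :> R by rewrite ltr0n (ltn_trans _ L2).
have L1 : 0 < L%:R - 1 :> R by rewrite subr_gt0 ltr1n.
(* [expR (- T)] equals the square root, and [e] provides the strict inequality. *)
have Tq : sqrtr (2 * pi * expR 1 * (2 * L%:R * N / (L%:R - 1))) < expR (e - T).
  have -> : 2 * pi * expR 1 * (2 * L%:R * N / (L%:R - 1)) = expR (- T) ^+ 2.
    rewrite -expRM_natl mulrN expRN mulVKf// lnK.
      move: pi (@pi_gt0 R) (expR 1) (expR_gt0 (1 : R)) => x x0 y y0.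
      by field; rewrite !gt_eqF.
    by rewrite posrE divr_gt0// !mulr_gt0 ?expR_gt0 ?pi_gt0.
  by rewrite sqrtr_sqr ger0_norm ?expR_ge0// ltr_expR ltrDr.
have [C decC rateC] := exists_code_rate_ge (ltn0Sn k) N0 L2 cA iA Tq.
rewrite -leeBlDr//; apply: le_trans (ereal_sup_ubound _); last by exists C.
by move: rateC; rewrite expRK opprB.
Qed.
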